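(* Let $(A,B)$ be controllable and let $\Sigma\in\mathbb{S}^n$ be positive semi-definite. Consider the problem $$\text{(I)}\qquad \inf_{\lambda\in\mathbb{R}^p,\;P\in\mathbb{S}^n}\; c^\top\lambda-\operatorname{trace}(\Sigma P)$$ subject to $$\begin{pmatrix}A&B\\ I&0\end{pmatrix}^\top\begin{pmatrix}0&P\\ P&0\end{pmatrix}\begin{pmatrix}A&B\\ I&0\end{pmatrix}+\begin{pmatrix}Q(\lambda)&S(\lambda)\\ S(\lambda)^\top&R(\lambda)\end{pmatrix}\prec 0,\qquad N(\lambda)\succ 0,\qquad P\succ 0,$$ and the problem $$\text{(II)}\qquad \inf_{\lambda\in\mathbb{R}^p}\; c^\top\lambda-\operatorname{trace}(\Sigma P_+(\lambda))\quad\text{subject to}\quad N(\lambda)\succ0,\;\; P_+(\lambda)\succ 0,\;\;\lambda\in\mathcal{D},$$ where $\mathcal{D}$ is the set of $\lambda$ with $R(\lambda)\prec0$ for which the Riccati equation $F(P,\lambda)=0$ has an anti-stabilizing solution, and $P_+(\lambda)$ denotes that solution. Then (I) and (II) are equivalent, i.e., the optimal values of (I) and (II) coincide, and $\lambda\in\mathbb{R}^p$ is feasible for (II) if and only if there exists $P\in\mathbb{S}^n$ such that $(\lambda,P)$ is feasible for (I).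
   Context: $\mathbb{S}^n$ is the set of real symmetric $n\times n$ matrices; $\prec,\succ,\preceq,\succeq$ refer to the (strict/non-strict) definiteness order on symmetric matrices. Data: positive integers $n,m,p,r$; $A\in\mathbb{R}^{n\times n}$, $B\in\mathbb{R}^{n\times m}$, $c\in\mathbb{R}^p$, $\Sigma\in\mathbb{S}^n$; and affine matrix-valued functions of $\lambda\in\mathbb{R}^p$, $H(\lambda)=H_0+\sum_{i=1}^p\lambda_iH_i$ for $H\in\{N,Q,S,R\}$, with $Q_i\in\mathbb{S}^n$, $S_i\in\mathbb{R}^{n\times m}$, $R_i\in\mathbb{S}^m$, $N_i\in\mathbb{S}^r$ for $i=0,\dots,p$. For $\lambda$ with $R(\lambda)$ invertible and $P\in\mathbb{S}^n$ define $$F(P,\lambda)=A^\top P+PA+Q(\lambda)-(PB+S(\lambda))R(\lambda)^{-1}(PB+S(\lambda))^\top .$$ A solution $P\in\mathbb{S}^n$ of $F(P,\lambda)=0$ is called anti-stabilizing if all eigenvalues of $A-BR(\lambda)^{-1}(PB+S(\lambda))^\top$ have positive real part; such a solution is unique if it exists. The optimal value is the infimum of the objective over the feasible set (with value $+\infty$ if the feasible set is empty). *)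

(* Defs.v *)
From HB Require Import structures.
From mathcomp Require Import all_boot all_order all_algebra.
From mathcomp Require Import boolp classical_sets reals constructive_ereal ereal.
From mathcomp Require Import complex.

Set Implicit Arguments.
Unset Strict Implicit.
Unset Printing Implicit Defensive.

Import Order.TTheory GRing.Theory Num.Theory.
Local Open Scope ring_scope.
Local Open Scope classical_set_scope.

Section Definiteness.
Context (R : realType) (k : nat).

Definition qform (M : 'M[R]_k) (x : 'cV[R]_k) : R := (x^T *m M *m x) 0 0.

(* Symmetry is part of every definiteness predicate: the definiteness order
   lives on the space of real symmetric matrices. *)
Definition posdef (M : 'M[R]_k) : Prop :=
  M \is symmetricmx /\ forall x : 'cV[R]_k, x != 0 -> 0 < qform M x.

Definition possemidef (M : 'M[R]_k) : Prop :=
  M \is symmetricmx /\ forall x : 'cV[R]_k, 0 <= qform M x.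

Definition negdef (M : 'M[R]_k) : Prop := posdef (- M).

End Definiteness.

(* Kalman's rank condition on (B, A B, ..., A^(n-1) B). *)
Definition controllable (R : realType) (n m : nat)
    (A : 'M[R]_n) (B : 'M[R]_(n, m)) : Prop :=
  \rank (\mxrow_(i < n) ((A ^+ i) *m B)) = n.

(* Index 0 carries the constant term H_0 and index i.+1 the coefficient of the
   i-th (counted from 0) entry of l. *)
Definition affine_mx (R : realType) (p k1 k2 : nat)
    (H : 'I_p.+1 -> 'M[R]_(k1, k2)) (l : 'cV[R]_p) : 'M[R]_(k1, k2) :=
  H ord0 + \sum_(i < p) l i 0 *: H (lift ord0 i).

Section Problems.
Context (R : realType) (n m p r : nat).
Context (A : 'M[R]_n) (B : 'M[R]_(n, m)) (c : 'cV[R]_p) (Sigma : 'M[R]_n).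
Context (N : 'I_p.+1 -> 'M[R]_r) (Q : 'I_p.+1 -> 'M[R]_n)
        (S : 'I_p.+1 -> 'M[R]_(n, m)) (Rm : 'I_p.+1 -> 'M[R]_m).

Definition riccati (P : 'M[R]_n) (l : 'cV[R]_p) : 'M[R]_n :=
  A^T *m P + P *m A + affine_mx Q l
  - (P *m B + affine_mx S l) *m invmx (affine_mx Rm l)
      *m (P *m B + affine_mx S l)^T.

Definition closed_loop (P : 'M[R]_n) (l : 'cV[R]_p) : 'M[R]_n :=
  A - B *m invmx (affine_mx Rm l) *m (P *m B + affine_mx S l)^T.

Definition antistable (M : 'M[R]_n) : Prop :=
  forall z : complex R,
    eigenvalue (map_mx (real_complex R) M) z -> 0 < complex.Re z.

Definition antistabilizing_solution (l : 'cV[R]_p) (P : 'M[R]_n) : Prop :=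
  [/\ P \is symmetricmx, riccati P l = 0 & antistable (closed_loop P l)].

Definition riccati_domain : set 'cV[R]_p :=
  [set l | negdef (affine_mx Rm l) /\ exists P, antistabilizing_solution l P].

(* The anti-stabilizing solution, which is unique for l in riccati_domain;
   the default value 0 is only taken when there is none. *)
Definition P_plus (l : 'cV[R]_p) : 'M[R]_n :=
  xget 0 [set P | antistabilizing_solution l P].

Definition objective (l : 'cV[R]_p) (P : 'M[R]_n) : R :=
  (c^T *m l) 0 0 - \tr (Sigma *m P).

Definition lmi_mx (l : 'cV[R]_p) (P : 'M[R]_n) : 'M[R]_(n + m) :=
  (block_mx A B 1%:M 0)^T *m block_mx 0 P P 0 *m block_mx A B 1%:M 0
  + block_mx (affine_mx Q l) (affine_mx S l)
             (affine_mx S l)^T (affine_mx Rm l).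

Definition feasible_I (l : 'cV[R]_p) (P : 'M[R]_n) : Prop :=
  [/\ P \is symmetricmx, negdef (lmi_mx l P),
      posdef (affine_mx N l) & posdef P].

Definition feasible_II (l : 'cV[R]_p) : Prop :=
  [/\ posdef (affine_mx N l), posdef (P_plus l) & riccati_domain l].

(* ereal_inf of the empty set is +oo. *)
Definition value_I : \bar R :=
  ereal_inf [set (objective lP.1 lP.2)%:E | lP in
               [set lP : 'cV[R]_p * 'M[R]_n | feasible_I lP.1 lP.2]].

Definition value_II : \bar R :=
  ereal_inf [set (objective l (P_plus l))%:E | l in [set l | feasible_II l]].

End Problems.

(* Main.v *)
(** Write [F] for the Riccati map at a fixed multiplier [l], [K] for the closed loop
    matrix at [P], and [G = B (- R)^-1 B^T >= 0]; then
    [F(P + D) = F(P) + K^T D + D K + D G D]. By a Schur complement the linear matrix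
    inequality says [R < 0] and [F(P) < 0].

    If [Pp] is anti-stabilizing and [F(P) < 0], then [X = Pp - P] satisfies
    [K^T X + X K = - F(P) + X G X > 0] with [K] anti-stable, so [P < Pp] by
    Lyapunov's theorem, and [trace (Sigma P) <= trace (Sigma Pp)]. Conversely, if
    [K^T X + X K = 1] then [F(Pp - t X) = - t + t^2 X G X < 0] for small [t > 0], so
    [Pp] is a limit of feasible points.

    An anti-stabilizing solution exists as soon as [F(P) < 0] for some [P]: it is
    [P + X] where [K^T X + X K + X G X = - F(P)] and [K + G X] is anti-stable. Such an
    [X] is the limit of the decreasing Newton iteration for this equation, started at
    an anti-stabilizing feedback which controllability provides. *)

Require Import Defs.
From HB Require Import structures.
From mathcomp Require Import all_boot all_order all_algebra.
From mathcomp Require Import boolp classical_sets reals constructive_ereal ereal.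
From mathcomp Require Import topology normedtype sequences.
From mathcomp Require Import complex spectral ring lra.

Set Implicit Arguments.
Unset Strict Implicit.
Unset Printing Implicit Defensive.

Import Order.TTheory GRing.Theory Num.Theory.
Import numFieldNormedType.Exports.
Local Open Scope ring_scope.
Local Open Scope classical_set_scope.

(** * Lyapunov's inequality over the complex numbers *)

Section HermitianLyapunov.
Local Open Scope sesquilinear_scope.

Lemma mulmxct (C : numClosedFieldType) (k l q : nat) (M : 'M[C]_(k, l)) (L : 'M[C]_(l, q)) :
  (M *m L)^t* = L^t* *m M^t*.
Proof. by rewrite trmx_mul map_mxM. Qed.

(* Induction on the dimension. With [y] the first column of [X] below the corner
   [a = X 0 0], divided by [a], the vectors [(- u y, u)] are [X]-orthogonal to the first
   basis vector, and on them the inequality restricts to one for the Schur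
   complement [Sc] and the lower right block [T2]. *)
Lemma trigonal_lyapunov (C : numClosedFieldType) (n : nat) (T X : 'M[C]_n) :
  is_trig_mx T -> (forall i, 0 < 'Re (T i i)) -> X^t* = X ->
  (forall v : 'rV_n, v != 0 -> 0 < (v *m (T *m X + X *m T^t*) *m v^t*) 0 0) ->
  forall v : 'rV_n, v != 0 -> 0 < (v *m X *m v^t*) 0 0.
Proof.
move=> trigT; move: X; elim/trigsqmx_ind: T / trigT => [|{}n z b T2 _ IHn] X reT hermX posW v vN0.
  by rewrite thinmx0 eqxx in vN0.
pose a : C := X 0 0; pose x := dlsubmx (X : 'M_(1 + n)).
pose X2 := drsubmx (X : 'M_(1 + n)); pose y : 'cV_n := a^-1 *: x.
have aR : a^* = a by rewrite /a -[in RHS]hermX !mxE.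
have XE : X = block_mx a%:M (x^t*) x X2.
  rewrite -[X in LHS]submxK; congr block_mx.
    by rewrite [LHS]mx11_scalar; congr _%:M; rewrite !mxE; congr (X _ _); apply/val_inj.
  by apply/matrixP => i j; rewrite !mxE -[in LHS]hermX !mxE.
have hermX2 : X2^t* = X2.
  by apply/matrixP => i j; rewrite !mxE -[in RHS]hermX !mxE.
have z00 : z = (z 0 0)%:M by exact: mx11_scalar.
have z_gt0 : 0 < 'Re (z 0 0).
  have := reT (lshift n 0); by rewrite block_mxEul.
have a_gt0 : 0 < a.
  have := posW (row_mx 1 0); rewrite row_mx_eq0 oner_eq0 /= => /(_ isT).
  rewrite XE z00 tr_block_mx map_block_mx !mulmx_block add_block_mx mul_row_block.
  rewrite tr_row_mx map_col_mx mul_row_col !(mul0mx, mulmx0, addr0, trmx0, map_mx0, mul1mx).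
  rewrite trmx1 map_mx1 mulmx1 tr_scalar_mx map_scalar_mx -!scalar_mxM -raddfD mxE eqxx mulr1n.
  rewrite /= [a * _]mulrC -mulrDl.
  have -> : z 0 0 + (z 0 0)^* = 'Re (z 0 0) *+ 2.
    by rewrite ReE -mulr_natr divfK // pnatr_eq0.
  by rewrite pmulr_rgt0 // pmulrn_lgt0.
have aN0 : a != 0 by rewrite gt_eqF.
pose Sc := X2 - y *m x^t*.
have xE : x = a *: y by rewrite scalerA divff // scale1r.
have yxE : y *m x^t* = x *m y^t*.
  have xct : x^t* = a *: y^t* by apply/matrixP => i j; rewrite xE !mxE rmorphM /= aR.
  by rewrite xct xE -scalemxAr -scalemxAl.
have hermS : Sc^t* = Sc.
  rewrite /Sc linearB /= map_mxB hermX2 mulmxct trmxCK yxE //.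
have vXE (u : 'rV_n) : row_mx (- (u *m y)) u *m X = row_mx 0 (u *m Sc).
  rewrite XE mul_row_block mulNmx mulmxBr mulNmx mulmxA.
  rewrite mul_mx_scalar scalemxAr -xE.
  by rewrite addNr addrC.
have posS (u : 'rV_n) : u != 0 -> 0 < (u *m Sc *m u^t*) 0 0.
  apply: IHn => // [i|{}u uN0].
    by have := reT (rshift 1 i); rewrite block_mxEdr.
  have := posW (row_mx (- (u *m y)) u).
  rewrite row_mx_eq0 negb_and uN0 orbT => /(_ isT).
  rewrite mulmxDr mulmxDl !mulmxA vXE.
  (* [vXE] absorbs an [X] only directly behind the row vector, so the term with [T X] is read as the
     conjugate transpose of the one with [X T^*]. *)
  have -> : row_mx (- (u *m y)) u *m block_mx z 0 b T2 *m X *m (row_mx (- (u *m y)) u)^t*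
     = (row_mx 0 (u *m Sc) *m (block_mx z 0 b T2)^t* *m (row_mx (- (u *m y)) u)^t*)^t*.
    by rewrite 2!mulmxct !trmxCK -vXE mulmxct hermX !mulmxA.
  have -> : row_mx 0 (u *m Sc) *m (block_mx z 0 b T2) ^t* *m (row_mx (- (u *m y)) u)^t* = u *m
    Sc *m T2^t* *m u^t*.
    rewrite tr_block_mx map_block_mx mul_row_block tr_row_mx map_col_mx mul_row_col.
    by rewrite !(mul0mx, mulmx0, add0r, trmx0, map_mx0).
  by rewrite !mulmxct !trmxCK hermS -!mulmxA -mulmxDr !mulmxA -mulmxDl mulmxA.
move: vN0; rewrite -(hsubmxK v); set v1 := lsubmx _; set v2 := rsubmx _ => vN0.
pose w := (v1 + v2 *m y) 0 0.
have wE : v1 + v2 *m y = w%:M by exact: mx11_scalar.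
have formE : (row_mx v1 v2 *m (X : 'M_(1 + n)) *m (row_mx v1 v2)^t*) 0 0
    = a * (w * w^*) + (v2 *m Sc *m v2^t*) 0 0.
  (* A multiple [w] of the first basis vector plus an [X]-orthogonal remainder: the form splits
     without cross terms. *)
  have vE : row_mx v1 v2 = row_mx w%:M 0 + row_mx (- (v2 *m y)) v2.
    by rewrite add_row_mx add0r -wE addrK.
  rewrite [X in X *m _ *m _]vE mulmxDl vXE XE mul_row_block !mul0mx !addr0.
  rewrite tr_row_mx map_col_mx mulmxDl !mul_row_col mul0mx add0r mxE; congr (_ + _).
  rewrite -!mulmxA -mulmxDr.
  have -> : a%:M *m v1^t* + x^t* *m v2^t* = a *: (v1 + v2 *m y)^t*.
    rewrite linearD /= map_mxD mulmxct scalerDr mul_scalar_mx; congr (_ + _).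
    rewrite scalemxAl; congr (_ *m _).
    by apply/matrixP => i j; rewrite xE !mxE rmorphM /= aR.
  by rewrite wE tr_scalar_mx map_scalar_mx /= scale_scalar_mx -scalar_mxM mxE eqxx mulr1n mulrCA.
rewrite [ltRHS]formE.
have [v20|v2N0] := eqVneq v2 0.
  move: vN0; rewrite row_mx_eq0 v20 eqxx andbT => v1N0.
  rewrite !mul0mx mxE addr0 pmulr_rgt0 // mul_conjC_gt0.
  apply: contra_neq v1N0 => w0.
  by move: wE; rewrite v20 mul0mx addr0 w0 => ->; rewrite raddf0.
by rewrite ltr_wpDl ?posS // mulr_ge0 ?mul_conjC_ge0 // ltW.
Qed.

(** A unitary Schur form [T = P K P^*] reduces this to the triangular case: the diagonal of [T]
    consists of eigenvalues of [K], and congruence by [P] transports [X] and the inequality. *)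
Lemma hermitian_lyapunov (C : numClosedFieldType) (n : nat) (K X : 'M[C]_n) :
  (forall z, eigenvalue K z -> 0 < 'Re z) -> X^t* = X ->
  (forall v : 'rV_n, v != 0 -> 0 < (v *m (K *m X + X *m K^t*) *m v^t*) 0 0) ->
  forall v : 'rV_n, v != 0 -> 0 < (v *m X *m v^t*) 0 0.
Proof.
case: n => [|n] in K X * => reK hermX posW v vN0; first by rewrite thinmx0 eqxx in vN0.
have [P uP trigT] := Schur K isT.
rewrite /similar_to conjymx // in trigT; set T := _ *m _ in trigT.
have mulP_neq0 (w : 'rV_n.+1) : w != 0 -> w *m P != 0.
  by apply: contra_neq => wP0; rewrite -(mulmxtVK w uP) wP0 mul0mx.
have reT i : 0 < 'Re (T i i).
  have : eigenvalue T (T i i).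
    rewrite eigenvalue_root_char char_poly_trig // (bigD1 i) //= rootM.
    by rewrite root_XsubC eqxx.
  case/eigenvalueP => u uT /mulP_neq0 uPN0; apply: reK; apply/eigenvalueP.
  by exists (u *m P); rewrite // scalemxAl -uT /T !mulmxA mulmxKtV.
pose Y := P *m X *m P^t*.
have hermY : Y^t* = Y by rewrite /Y !mulmxct trmxCK hermX mulmxA.
have TYE : T *m Y + Y *m T^t* = P *m (K *m X + X *m K^t*) *m P^t*.
  rewrite /T /Y mulmxDr mulmxDl !mulmxct trmxCK !mulmxA.
  by congr (_ + _); rewrite mulmxKtV.
have posY : forall w : 'rV_n.+1, w != 0 -> 0 < (w *m Y *m w^t*) 0 0.
  apply: (trigonal_lyapunov trigT reT hermY) => w /mulP_neq0 wPN0; rewrite TYE.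
  by rewrite -!mulmxA -mulmxct !mulmxA; exact: posW.
have := posY (v *m P^t*); rewrite mulmxct trmxCK /Y !mulmxA !mulmxKtV //; apply.
by apply: contra_neq vN0 => vP0; rewrite -(mulmxKtV v uP) // vP0 mul0mx.
Qed.

End HermitianLyapunov.

Lemma symmetricmxP (F : fieldType) (n : nat) (M : 'M[F]_n) : M \is symmetricmx <-> M^T = M.
Proof.
rewrite qualifE /= expr0 scale1r map_mx_id //.
by split=> [/eqP {2}->|->].
Qed.

(** * Lyapunov equations over the reals *)

Section RealForms.
Local Open Scope sesquilinear_scope.
Context (R : realType).

Lemma trmx11 (F : nzRingType) (M : 'M[F]_1) : M^T = M.
Proof. by apply/matrixP => i j; rewrite mxE !ord1. Qed.

Definition bform (n k : nat) (M : 'M[R]_(n, k)) (x : 'cV[R]_n) (y : 'cV[R]_k) : R := (x^T *m M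
  *m y) 0 0.

Lemma bformC (n k : nat) (M : 'M[R]_(n, k)) x y : bform M x y = bform M^T y x.
Proof. by rewrite /bform -[in LHS](trmx11 (_ *m y)) !trmx_mul trmxK mulmxA. Qed.

(** With [v] split into real and imaginary parts, the two mixed terms cancel by symmetry of [X]. *)
Lemma complex_form_real (n : nat) (X : 'M[R]_n) (v : 'rV[R[i]]_n) : X^T = X ->
  (v *m map_mx (real_complex R) X *m v^t*) 0 0 =
  (qform X (map_mx (@complex.Re R) v)^T + qform X (map_mx (@complex.Im R) v)^T)%:C%C.
Proof.
move=> Xsym; set a := (map_mx _ v)^T; set b := (map_mx (@complex.Im R) v)^T.
pose f k l := @map_mx _ _ (real_complex R) k l.
have vE : v = f _ _ a^T + 'i%C *: f _ _ b^T.
  by apply/rowP => i; rewrite !mxE -complexE.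
have vE' : v^t* = f _ _ a - 'i%C *: f _ _ b.
  apply/colP => i; rewrite !mxE.
  by case: (v 0 i) => s t; rewrite /Num.conj /=; simpc.
have formE x y : (f _ _ x^T *m f _ _ X *m f _ _ y) 0 0 = (bform X x y)%:C%C.
  by rewrite /f -!map_mxM mxE.
rewrite -/(f n n X) vE' vE mulmxDl mulmxDl !mulmxBr -!scalemxAl -!scalemxAr scalerA.
have entryE (M1 M2 M3 M4 : 'M[R[i]]_1) :
    (M1 - 'i%C *: M2 + ('i%C *: M3 - ('i%C * 'i%C) *: M4)) 0 0
    = M1 0 0 - 'i%C * M2 0 0 + ('i%C * M3 0 0 - ('i%C * 'i%C) * M4 0 0).
  by rewrite !mxE.
rewrite entryE !formE (bformC X b a) Xsym -expr2 sqr_i mulN1r opprK.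
by rewrite rmorphD /= addrA subrK.
Qed.

Lemma posdef_complex (n : nat) (X : 'M[R]_n) (v : 'rV[R[i]]_n) :
  posdef X -> v != 0 -> 0 < (v *m map_mx (real_complex R) X *m v^t*) 0 0.
Proof.
move=> [/symmetricmxP Xsym posX] vN0; rewrite complex_form_real // ltcR.
have qge0 y : 0 <= qform X y.
  have [->|/posX/ltW//] := eqVneq y 0.
  by rewrite /qform mulmx0 mxE.
have [a0|aN0] := eqVneq (map_mx (@complex.Re R) v)^T 0; last first.
  by rewrite ltr_pwDl ?posX.
have [b0|bN0] := eqVneq (map_mx (@complex.Im R) v)^T 0; last first.
  by rewrite ltr_wpDl ?posX.
case/negP: vN0; apply/eqP/rowP => i; rewrite mxE [LHS]complexE.
have := congr1 (fun A : 'cV[R]_n => A i 0) a0; rewrite !mxE => ->.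
have := congr1 (fun A : 'cV[R]_n => A i 0) b0; rewrite !mxE => ->.
by rewrite mulr0 addr0.
Qed.

Lemma char_poly_tr (F : comNzRingType) (n : nat) (M : 'M[F]_n) : char_poly M^T = char_poly M.
Proof.
rewrite /char_poly -[RHS]det_tr; congr (\det _).
by apply/matrixP => i j; rewrite !mxE eq_sym.
Qed.

Lemma eigenvalue_tr (F : fieldType) (n : nat) (M : 'M[F]_n) z : eigenvalue M^T z = eigenvalue M z.
Proof. by rewrite !eigenvalue_root_char char_poly_tr. Qed.

(** The complex result is applied to [M^T], since the forms there act on row vectors. *)
Lemma lyapunov_posdef (n : nat) (M X : 'M[R]_n) :
  antistable M -> X^T = X -> posdef (M^T *m X + X *m M) -> posdef X.
Proof.
move=> asM Xsym posW; split; first exact/symmetricmxP.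
have fct k l (Y : 'M[R]_(k, l)) :
    (map_mx (real_complex R) Y)^t* = map_mx (real_complex R) Y^T.
  by apply/matrixP => i j; rewrite !mxE; exact: conjc_real.
have reK z : eigenvalue (map_mx (real_complex R) M^T) z -> 0 < 'Re z.
  by rewrite -map_trmx eigenvalue_tr -complexRe ltcR; exact: asM.
have hermX : (map_mx (real_complex R) X)^t* = map_mx (real_complex R) X by rewrite fct Xsym.
move=> x xN0.
have := hermitian_lyapunov reK hermX _ (v := map_mx (real_complex R) x^T).
rewrite !fct !trmxK -!map_mxM -map_mxD mxE ltcR; apply.
  by move=> v vN0; exact: posdef_complex.
by rewrite map_mx_eq0 trmx_eq0.
Qed.

Lemma antistable_tr (n : nat) (M : 'M[R]_n) : antistable M -> antistable M^T.
Proof. by move=> asM z; rewrite -map_trmx eigenvalue_tr; apply: asM. Qed.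

(** If [v M^T = z v], the form of [M^T X + X M] at [v] is [z + z^*] times that of [X], and both
    forms are positive. *)
Lemma lyapunov_antistable (n : nat) (M X : 'M[R]_n) :
  posdef X -> posdef (M^T *m X + X *m M) -> antistable M.
Proof.
move=> posX posW z; rewrite -eigenvalue_tr => /eigenvalueP[v vM vN0].
have vM' : map_mx (real_complex R) M *m v^t* = z^* *: v^t*.
  have -> : map_mx (real_complex R) M = (map_mx (real_complex R) M)^T^t*.
    by apply/matrixP => i j; rewrite !mxE; symmetry; exact: conjc_real.
  rewrite -mulmxct vM; apply/matrixP => i j; by rewrite !mxE rmorphM.
have := posdef_complex posW vN0.
rewrite map_mxD !map_mxM -map_trmx mulmxDr mulmxDl !mulmxA vM.
rewrite -[_ *m map_mx _ M *m _]mulmxA vM' -!scalemxAl -!scalemxAr -scalerDl mxE.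
rewrite pmulr_lgt0 ?posdef_complex // [z + _]addcJ pmulr_rgt0 ?ltr0n // ltcR.
exact.
Qed.

(* [Y] intertwines [M] and [- M^T], hence [p(- M^T) Y = Y p(M) = 0] for the
   characteristic polynomial [p] of [M], and [p(- M^T)] is invertible because
   [M] and [- M^T] have no common eigenvalue. *)
Lemma lyapunov_injective (n : nat) (M Y : 'M[R]_n) :
  antistable M -> M^T *m Y + Y *m M = 0 -> Y = 0.
Proof.
case: n => [|n] in M Y *; first by rewrite [Y]flatmx0.
move=> asM /eqP; rewrite addrC addr_eq0 => /eqP YM.
pose K := map_mx (real_complex R) M; pose Y' := map_mx (real_complex R) Y.
have YK : Y' *m K = - K^T *m Y'.
  by rewrite -map_mxM YM map_mxN map_mxM map_trmx mulNmx.
have intertwine p : Y' *m horner_mx K p = horner_mx (- K^T) p *m Y'.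
  elim/poly_ind: p => [|p d IHp]; first by rewrite !rmorph0 mulmx0 mul0mx.
  rewrite !rmorphD !rmorphM /= !horner_mx_X !horner_mx_C mulmxDr mulmxDl.
  by rewrite -!mulmxE mulmxA IHp -!mulmxA YK scalar_mxC.
have := intertwine (char_poly K).
rewrite Cayley_Hamilton mulmx0.
have [rs rsE] := closed_field_poly_normal (char_poly K).
rewrite (monicP (char_poly_monic K)) scale1r in rsE.
have rsP z : z \in rs -> 0 < complex.Re z.
  move=> zrs; apply: asM; rewrite eigenvalue_root_char -/K rsE.
  by rewrite root_prod_XsubC.
rewrite rsE => /esym H.
(* A singular factor [- K^T - z] would make [- z] an eigenvalue of [K], although [z] has positive
   real part. *)
have unitp : horner_mx (- K^T) (\prod_(z <- rs) ('X - z%:P)) \in unitmx.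
  elim: rs {rsE H} rsP => [|z rs IHrs] rsP; first by rewrite big_nil rmorph1 unitmx1.
  rewrite big_cons rmorphM /= -mulmxE unitmx_mul IHrs ?andbT; last first.
    by move=> t trs; apply: rsP; rewrite inE trs orbT.
  rewrite rmorphB /= horner_mx_X horner_mx_C -row_free_unit -kermx_eq0.
  apply: contraT => nz.
  have /eigenvalueP[u uK uN0] : eigenvalue (- K^T) z by [].
  have : eigenvalue K (- z).
    rewrite -eigenvalue_tr; apply/eigenvalueP; exists u => //.
    by rewrite scaleNr -uK mulmxN opprK.
  move/asM; have := rsP z (mem_head _ _).
  rewrite raddfN oppr_gt0 => h1 h2.
  by have := lt_trans h1 h2; rewrite ltxx.
have Y0 : Y' = 0 by rewrite -[Y'](mulKmx unitp) H mulmx0.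
by apply/eqP; move/eqP: Y0; rewrite map_mx_eq0.
Qed.

(** Vectorization turns the Lyapunov operator into a square matrix [L], invertible because
    injective. The transpose of the solution solves the same equation, whence symmetry. *)
Lemma lyapunov_solution (n : nat) (M W : 'M[R]_n) : antistable M -> W^T = W ->
  exists2 X : 'M[R]_n, X^T = X & M^T *m X + X *m M = W.
Proof.
move=> asM Wsym; pose L := lin_mx (mulmx M^T) + lin_mx (mulmxr M) : 'M[R]_(n * n).
have LE X : mxvec X *m L = mxvec (M^T *m X + X *m M).
  by rewrite mulmxDr !mul_vec_lin /= linearD.
have Lunit : L \in unitmx.
  rewrite -row_free_unit; apply: inj_row_free => v.
  rewrite -[v]vec_mxK LE => /eqP; rewrite mxvec_eq0 => /eqP /(lyapunov_injective asM) ->.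
  by rewrite linear0.
pose X := vec_mx (mxvec W *m invmx L).
have XE : M^T *m X + X *m M = W.
  by apply: (can_inj mxvecK); rewrite -LE vec_mxK mulmxKV.
exists X => //; apply/eqP; rewrite -subr_eq0; apply/eqP.
apply: (lyapunov_injective asM); rewrite mulmxBr mulmxBl addrACA -opprD XE.
by rewrite -[X in _ - X]Wsym -XE linearD /= !trmx_mul !trmxK [X in _ - X]addrC subrr.
Qed.

End RealForms.

(** * Definite matrices *)

Section Definite.
Context (R : realType).

Lemma posdef_tr (n : nat) (M : 'M[R]_n) : posdef M -> M^T = M.
Proof. by case=> /symmetricmxP. Qed.

Lemma possemidef_tr (n : nat) (M : 'M[R]_n) : possemidef M -> M^T = M.
Proof. by case=> /symmetricmxP. Qed.

Lemma qform0 (n : nat) (M : 'M[R]_n) : qform M 0 = 0.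
Proof. by rewrite /qform mulmx0 mxE. Qed.

Lemma qformD (n : nat) (M L : 'M[R]_n) x : qform (M + L) x = qform M x + qform L x.
Proof. by rewrite /qform mulmxDr mulmxDl mxE. Qed.

Lemma qformN (n : nat) (M : 'M[R]_n) x : qform (- M) x = - qform M x.
Proof. by rewrite /qform mulmxN mulNmx mxE. Qed.

Lemma qformB (n : nat) (M L : 'M[R]_n) x : qform (M - L) x = qform M x - qform L x.
Proof. by rewrite qformD qformN. Qed.

Lemma qformZ (n : nat) t (M : 'M[R]_n) x : qform (t *: M) x = t * qform M x.
Proof. by rewrite /qform -scalemxAr -scalemxAl mxE. Qed.

Lemma qform_congr (n k : nat) (M : 'M[R]_n) (L : 'M[R]_(n, k)) x :
  qform (L^T *m M *m L) x = qform M (L *m x).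
Proof. by rewrite /qform trmx_mul !mulmxA. Qed.

Lemma qform1E (n : nat) (x : 'cV[R]_n) : qform 1%:M x = \sum_i x i 0 ^+ 2.
Proof. by rewrite /qform mulmx1 mxE; apply: eq_bigr => i _; rewrite mxE expr2. Qed.

Lemma posdef1 (n : nat) : posdef (1%:M : 'M[R]_n).
Proof.
split; first by apply/symmetricmxP; rewrite tr_scalar_mx.
move=> x xN0; rewrite qform1E lt_neqAle sumr_ge0 ?andbT => [|i _]; last exact: sqr_ge0.
apply: contra_neq xN0 => /esym/psumr_eq0P x0; apply/colP => i; rewrite mxE.
by apply/eqP; rewrite -sqrf_eq0; apply/eqP/x0 => // j _; exact: sqr_ge0.
Qed.

Lemma posdefW (n : nat) (M : 'M[R]_n) : posdef M -> possemidef M.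
Proof.
move=> [sM posM]; split=> // x; have [->|/posM/ltW//] := eqVneq x 0.
by rewrite qform0.
Qed.

Lemma possemidef0 (n : nat) : possemidef (0 : 'M[R]_n).
Proof.
by split=> [|x]; [apply/symmetricmxP; rewrite trmx0 | rewrite /qform mulmx0 mul0mx mxE].
Qed.

Lemma posdefD (n : nat) (M L : 'M[R]_n) : posdef M -> possemidef L -> posdef (M + L).
Proof.
move=> [/symmetricmxP sM pM] [/symmetricmxP sL pL]; split.
  by apply/symmetricmxP; rewrite linearD /= sM sL.
by move=> x xN0; rewrite qformD ltr_pwDl ?pM.
Qed.

Lemma possemidefD (n : nat) (M L : 'M[R]_n) : possemidef M -> possemidef L -> possemidef (M + L).
Proof.
move=> [/symmetricmxP sM pM] [/symmetricmxP sL pL]; split.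
  by apply/symmetricmxP; rewrite linearD /= sM sL.
by move=> x; rewrite qformD addr_ge0.
Qed.

Lemma posdefZ (n : nat) t (M : 'M[R]_n) : 0 < t -> posdef M -> posdef (t *: M).
Proof.
move=> t0 [/symmetricmxP sM pM]; split; first by apply/symmetricmxP; rewrite linearZ /= sM.
by move=> x xN0; rewrite qformZ mulr_gt0 ?pM.
Qed.

Lemma possemidef_congr (n k : nat) (M : 'M[R]_n) (L : 'M[R]_(n, k)) :
  possemidef M -> possemidef (L^T *m M *m L).
Proof.
move=> [/symmetricmxP sM pM]; split; last by move=> x; rewrite qform_congr.
by apply/symmetricmxP; rewrite !trmx_mul trmxK sM mulmxA.
Qed.

Lemma posdef_unitmx (n : nat) (M : 'M[R]_n) : posdef M -> M \in unitmx.
Proof.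
move=> [_ pM]; rewrite -row_free_unit; apply: inj_row_free => v vM.
apply/eqP; apply: contraT => vN0; have /pM : v^T != 0 by rewrite trmx_eq0.
by rewrite /qform trmxK vM mul0mx mxE ltxx.
Qed.

Lemma posdef_inv (n : nat) (M : 'M[R]_n) : posdef M -> posdef (invmx M).
Proof.
move=> pM; have uM := posdef_unitmx pM; have sM := posdef_tr pM.
have sI : (invmx M)^T = invmx M by rewrite trmx_inv sM.
split; first exact/symmetricmxP.
move=> x xN0; have -> : invmx M = (invmx M)^T *m M *m invmx M by rewrite sI mulVmx // mul1mx.
rewrite qform_congr; case: pM => _; apply; apply: contra_neq xN0 => x0.
by rewrite -(mulKVmx uM x) x0 mulmx0.
Qed.

Lemma qform_addZ (n : nat) (M : 'M[R]_n) (x y : 'cV[R]_n) t : M^T = M ->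
  qform M (x + t *: y) = qform M x + t * bform M y x *+ 2 + t ^+ 2 * qform M y.
Proof.
move=> sM.
have -> : qform M (x + t *: y)
    = qform M x + t * bform M x y + (t * bform M y x + t * (t * qform M y)).
  rewrite /qform /bform [(x + _)^T]linearD /= [(_ *: y)^T]linearZ /= mulmxDl mulmxDl !mulmxDr
    -!scalemxAl -!scalemxAr.
  by rewrite !mxE.
by rewrite (bformC M x) sM; ring.
Qed.

(** On the line [x + t y] with [y = M x] the form is [2 t |y|^2 + t^2 q(y)], which takes negative
    values unless [y = 0]. In the choice of [t], the denominator [k + 1] stays positive even for
    [k = 0]. *)
Lemma possemidef_ker (n : nat) (M : 'M[R]_n) x : possemidef M -> qform M x = 0 -> M *m x = 0.
Proof.
move=> pM x0; have sM := possemidef_tr pM.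
pose y := M *m x; pose s := qform 1%:M y; pose k := qform M y.
have k0 : 0 <= k by exact: pM.2.
have yE : bform M y x = s by rewrite /s /qform /bform mulmx1 -mulmxA.
have := pM.2 (x + (- s / (k + 1)) *: y).
rewrite qform_addZ // x0 yE add0r -/k.
have -> : - s / (k + 1) * s *+ 2 + (- s / (k + 1)) ^+ 2 * k = - (s / (k + 1)) ^+ 2 * (k + 2).
  by field; rewrite gt_eqF // ltr_wpDl.
rewrite mulNr oppr_ge0 => h.
have {h} : (s / (k + 1)) ^+ 2 * (k + 2) == 0.
  by rewrite eq_le h mulr_ge0 ?sqr_ge0 // addr_ge0.
rewrite mulf_eq0 sqrf_eq0 mulf_eq0 invr_eq0 ![_ + _ == 0]gt_eqF ?ltr_wpDl ?orbF //.
move=> /eqP s0; apply/eqP; apply: contraT => yN0.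
by have := (posdef1 n).2 y yN0; rewrite -/s s0 ltxx.
Qed.

Lemma symmetric_bounded (n : nat) (M : 'M[R]_n) : M^T = M ->
  exists2 b : R, 0 < b & posdef (b *: 1%:M - M).
Proof.
(* Each [|x_i x_j|] is at most [|x|^2], so [c] bounds the form; the extra 1 makes the bound
   strict. *)
move=> sM; pose c := \sum_i \sum_j `|M i j|; exists (1 + c).
  by rewrite ltr_pwDl // !sumr_ge0 // => i _; rewrite sumr_ge0.
split; first by apply/symmetricmxP; rewrite linearB linearZ /= tr_scalar_mx sM.
move=> x xN0; rewrite qformB qformZ mulrDl mul1r addrAC -addrA.
rewrite ltr_pwDl ?(posdef1 n).2 // addrC subr_ge0 /c mulr_suml.
have -> : qform M x = \sum_i \sum_j M i j * (x i 0 * x j 0).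
  rewrite /qform mxE exchange_big /=; apply: eq_bigr => j _.
  by rewrite !mxE mulr_suml; apply: eq_bigr => i _; rewrite !mxE; ring.
apply: ler_sum => i _; rewrite mulr_suml; apply: ler_sum => j _.
apply: le_trans (ler_norm _) _; rewrite normrM ler_wpM2l //.
have ge k : `|x k 0| ^+ 2 <= qform 1%:M x.
  rewrite qform1E real_normK ?num_real // (bigD1 k) //= lerDl sumr_ge0 // => l _.
  exact: sqr_ge0.
have := ge i; have := ge j; rewrite normrM.
have := sqr_ge0 (`|x i 0| - `|x j 0|).
move: `|x i 0| `|x j 0| (qform _ _) => p q r; nra.
Qed.

(* Completing the square: [0 <= q(x - X^-1 x / b)] and [X^-1 <= b]. *)
Lemma posdef_coercive (n : nat) (X : 'M[R]_n) : posdef X ->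
  exists2 d : R, 0 < d & possemidef (X - d *: 1%:M).
Proof.
move=> pX; have pI := posdef_inv pX.
have [b b0 pb] := symmetric_bounded (posdef_tr pI).
exists b^-1; first by rewrite invr_gt0.
split; first by apply/symmetricmxP; rewrite linearB linearZ /= tr_scalar_mx (posdef_tr pX).
move=> x; rewrite qformB qformZ.
have := (posdefW pX).2 (x + (- b^-1) *: (invmx X *m x)).
rewrite qform_addZ ?posdef_tr //.
have -> : bform X (invmx X *m x) x = qform 1%:M x.
  by rewrite /bform /qform trmx_mul (posdef_tr pI) mulmx1 mulmxKV ?posdef_unitmx.
have -> : qform X (invmx X *m x) = qform (invmx X) x.
  by rewrite -qform_congr (posdef_tr pI) mulVmx ?posdef_unitmx ?mul1mx.
have := (posdefW pb).2 x; rewrite qformB qformZ => h1 h2.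
have bV0 : 0 < b^-1 by rewrite invr_gt0.
have : b^-1 ^+ 2 * qform (invmx X) x <= b^-1 * qform 1%:M x.
  have -> : b^-1 * qform 1%:M x = b^-1 ^+ 2 * (b * qform 1%:M x) by field; rewrite gt_eqF.
  by rewrite ler_wpM2l ?sqr_ge0 // -subr_ge0.
move: h2; rewrite sqrrN mulNr; move: (b^-1 * _) (_ * qform (invmx X) x) (qform X x) => s t u.
lra.
Qed.

Lemma posdef_perturb (n : nat) (X Y : 'M[R]_n) : posdef X -> Y^T = Y ->
  exists2 e : R, 0 < e & forall t, 0 <= t <= e -> posdef (X - t *: Y).
Proof.
move=> pX sY; have [d d0 [_ pd]] := posdef_coercive pX.
have [b b0 [_ pb]] := symmetric_bounded sY.
(* From [X >= d] and [Y < b], the matrix [X - t Y] keeps at least [d / 2] in this range of [t]. *)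
exists (d / (b *+ 2)); first by rewrite divr_gt0 // pmulrn_lgt0.
move=> t /andP[t0 te]; split.
  by apply/symmetricmxP; rewrite linearB linearZ /= sY (posdef_tr pX).
move=> x xN0; have := pd x; have := pb x xN0; have := (posdef1 n).2 x xN0.
rewrite !qformB !qformZ; move: (qform 1%:M x) (qform Y x) (qform X x) => q1 qY qX.
move=> h1 h2 h3.
have : t * (b *+ 2) <= d by rewrite -ler_pdivlMr // pmulrn_lgt0.
move=> tb.
have : t * qY <= t * (b * q1) by rewrite ler_wpM2l // ltW // -subr_gt0.
have : t * (b *+ 2) * q1 <= d * q1 by rewrite ler_wpM2r // ltW.
have : 0 < d * q1 by rewrite mulr_gt0.
lra.
Qed.
End Definite.

(** * Schur complements, Cholesky factors and traces *)

Section Blocks.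
Context (R : realType).

Lemma qform_block_schur (n m : nat) (E : 'M[R]_n) (f : 'M[R]_(n, m)) (G : 'M[R]_m) u v :
  G \in unitmx -> G^T = G ->
  qform (block_mx E f f^T G) (col_mx u v) =
  qform (E - f *m invmx G *m f^T) u + qform G (v + invmx G *m f^T *m u).
Proof.
move=> uG sG; set S := E - _; set w := v + _.
have sI : (invmx G)^T = invmx G by rewrite trmx_inv sG.
rewrite {1}/qform -mulmxA mul_block_col.
have -> : E *m u + f *m v = S *m u + f *m w.
  by rewrite /S /w mulmxDr mulmxBl !mulmxA [f *m v + _]addrC addrA subrK.
have -> : f^T *m u + G *m v = G *m w.
  by rewrite /w mulmxDr !mulmxA mulmxV // mul1mx addrC.
have uf : u^T *m f = (invmx G *m f^T *m u)^T *m G.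
  by rewrite !trmx_mul trmxK sI -!mulmxA mulVmx // mulmx1.
rewrite tr_col_mx mul_row_col mulmxDr !mulmxA uf -addrA -!mulmxDl mxE.
by rewrite -linearD /= [_ + v]addrC.
Qed.

Lemma posdef_block (n m : nat) (E : 'M[R]_n) (f : 'M[R]_(n, m)) (G : 'M[R]_m) :
  E^T = E ->
  posdef (block_mx E f f^T G) <-> posdef G /\ posdef (E - f *m invmx G *m f^T).
Proof.
move=> sE; split=> [pW|[pG pS]].
  have sG : G^T = G.
    have := posdef_tr pW; rewrite tr_block_mx => /(congr1 drsubmx).
    by rewrite !block_mxKdr.
  have pG : posdef G.
    split; first exact/symmetricmxP.
    move=> v vN0; have : col_mx (0 : 'cV_n) v != 0 by rewrite col_mx_eq0 eqxx.
    move=> /pW.2; rewrite /qform tr_col_mx mul_row_block mul_row_col.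
    by rewrite trmx0 !mul0mx mulmx0 !add0r.
  split=> //; have uG := posdef_unitmx pG.
  have sI : (invmx G)^T = invmx G by rewrite trmx_inv sG.
  split; first by apply/symmetricmxP; rewrite linearB /= !trmx_mul trmxK sI sE mulmxA.
  (* This [v] annihilates the second square and leaves the Schur complement alone. *)
  move=> u uN0; pose v := - (invmx G *m f^T *m u).
  have : col_mx u v != 0 by rewrite col_mx_eq0 negb_and uN0.
  by move=> /pW.2; rewrite qform_block_schur // addNr qform0 addr0.
have sG := posdef_tr pG; have uG := posdef_unitmx pG.
split; first by apply/symmetricmxP; rewrite tr_block_mx trmxK sG sE.
move=> x; rewrite -(vsubmxK x); set u := usubmx x; set v := dsubmx x.
rewrite col_mx_eq0 negb_and qform_block_schur // => uvN0.
have [u0|uN0] := eqVneq u 0.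
  by rewrite u0 eqxx /= in uvN0; rewrite u0 qform0 add0r mulmx0 addr0 pG.2.
by rewrite ltr_pwDl ?pS.2 // (posdefW pG).2.
Qed.

(** Induction on the lower right block [G = L L^T]; the factor is block upper triangular, with the
    square root of the scalar Schur complement in its corner. *)
Lemma posdef_cholesky (n : nat) (D : 'M[R]_n) : posdef D -> exists L : 'M[R]_n, D = L *m L^T.
Proof.
elim: n D => [|n IHn] D; first by exists 0; rewrite [LHS]flatmx0 [RHS]flatmx0.
rewrite -[D]/(D : 'M_(1 + n)) => pD; have sD := posdef_tr pD.
pose E := ulsubmx (D : 'M_(1 + n)); pose f := ursubmx (D : 'M_(1 + n)).
pose G := drsubmx (D : 'M_(1 + n)).
have DE : D = block_mx E f f^T G.
  by rewrite /f trmx_ursub sD submxK.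
have sE : E^T = E by rewrite trmx11.
move: pD; rewrite DE => /(posdef_block _ _ sE)[pG pS].
have [L GE] := IHn _ pG; have uG := posdef_unitmx pG; have sG := posdef_tr pG.
have sI : (invmx G)^T = invmx G by rewrite trmx_inv sG.
set S := E - _ in pS; have SE : S = (S 0 0)%:M by exact: mx11_scalar.
have S0 : 0 <= S 0 0.
  have := (posdefW pS).2 1%:M; by rewrite /qform tr_scalar_mx mulmx1 mul1mx.
pose K : 'M_(1 + n) := block_mx (Num.sqrt (S 0 0))%:M (f *m invmx G *m L) 0 L.
exists K; rewrite -[RHS]/(K *m K^T : 'M_(1 + n)) /K.
rewrite tr_block_mx mulmx_block !trmx_mul tr_scalar_mx sI trmx0 !(mulmx0, mul0mx, add0r).
rewrite -scalar_mxM -expr2 sqr_sqrtr // -SE !mulmxA -GE -[_ *m L *m L^T]mulmxA -GE.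
by rewrite mulmxKV // mulmxV // mul1mx subrK.
Qed.

(** For [D = L L^T] the trace is that of [L^T M L], whose diagonal holds the values of the form of
    [M] at the columns of [L]. *)
Lemma trace_mul_ge0 (n : nat) (M D : 'M[R]_n) : possemidef M -> posdef D -> 0 <= \tr (M *m D).
Proof.
move=> pM /posdef_cholesky[L ->]; rewrite mulmxA mxtrace_mulC mulmxA.
apply: sumr_ge0 => i _.
have -> : (L^T *m M *m L) i i = qform M (L *m delta_mx i 0).
  by rewrite -qform_congr /qform trmx_delta -rowE -colE !mxE.
exact: pM.2.
Qed.

(** Adding [e Y], where [Y] solves the equation with right-hand side 1, reduces to the strict case
    for every [e > 0]. *)
Lemma lyapunov_possemidef (n : nat) (M X : 'M[R]_n) :
  antistable M -> X^T = X -> possemidef (M^T *m X + X *m M) -> possemidef X.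
Proof.
move=> asM sX pW; split; first exact/symmetricmxP.
have [|Y sY YE] := lyapunov_solution (W := 1%:M) asM; first by rewrite tr_scalar_mx.
have pY : posdef Y by apply: (lyapunov_posdef asM) => //; rewrite YE; exact: posdef1.
have pXY e : 0 < e -> posdef (X + e *: Y).
  move=> e0; apply: (lyapunov_posdef asM); first by rewrite linearD linearZ /= sX sY.
  rewrite mulmxDr mulmxDl addrACA -scalemxAr -scalemxAl -scalerDr YE addrC.
  by apply: posdefD => //; apply: posdefZ => //; exact: posdef1.
move=> x; rewrite leNgt; apply/negP => qX.
have qY := (posdefW pY).2 x.
(* For this [e] the form of [X + e Y] at [x] is [qform X x / (qform Y x + 1)], still negative. *)
have e0 : 0 < - qform X x / (qform Y x + 1) by rewrite divr_gt0 ?oppr_gt0 // ltr_wpDl.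
have := (posdefW (pXY _ e0)).2 x; rewrite qformD qformZ.
have -> : qform X x + - qform X x / (qform Y x + 1) * qform Y x = qform X x / (qform Y x + 1).
  by field; rewrite gt_eqF // ltr_wpDl.
by rewrite pmulr_lge0 ?invr_gt0 ?ltr_wpDl // leNgt qX.
Qed.

End Blocks.

(** * The Riccati equation by Newton's method *)

Section Kleinman.
Context (R : realType).

(* Bass' construction: for [b] large, [N = b - M] is anti-stable, the solution [Z]
   of [N Z + Z N^T = 2 G] is positive definite by controllability, and
   [(M + G Z^-1) Z + Z (M + G Z^-1)^T = 2 b Z]. *)
Lemma bass_antistable (n : nat) (M G : 'M[R]_n) : possemidef G ->
  (forall v : 'cV_n, (forall k, G *m iter k (mulmx M^T) v = 0) -> v = 0) ->
  exists X : 'M[R]_n, X^T = X /\ antistable (M + G *m X).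
Proof.
move=> pG ctrl; have sG := possemidef_tr pG.
have [|b b0 pb] := symmetric_bounded (M := M + M^T); first by rewrite linearD /= trmxK addrC.
pose N := (b *: 1%:M - M).
(* The identity serves as Lyapunov certificate: [N + N^T = 2 b - (M + M^T)]. *)
have asN : antistable N.
  apply: (lyapunov_antistable (posdef1 R n)); rewrite mul1mx mulmx1 /N.
  rewrite linearB linearZ /= tr_scalar_mx addrACA -opprD [M^T + M]addrC addrC addrA.
  apply: posdefD; last by apply: posdefW; apply: posdefZ => //; exact: posdef1.
  by rewrite addrC.
have [|Z sZ ZE] := lyapunov_solution (W := G + G) (antistable_tr asN).
  by rewrite linearD /= sG.
rewrite trmxK in ZE.
have pZ : possemidef Z.
  apply: (lyapunov_possemidef (antistable_tr asN)) => //.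
  by rewrite trmxK ZE; exact: possemidefD.
have NZ : N *m Z + Z *m N^T = b *: Z + b *: Z - (M *m Z + Z *m M^T).
  rewrite /N linearB linearZ /= tr_scalar_mx mulmxBl mulmxBr -scalemxAl -scalemxAr mul1mx mulmx1.
  by rewrite addrACA -opprD.
(* The kernel of [Z] lies in that of [G] and is stable under [M^T], so [ctrl] forces it to
   vanish. *)
have kerZ (v : 'cV_n) : Z *m v = 0 -> G *m v = 0 /\ Z *m (M^T *m v) = 0.
  move=> Zv.
  have vZ : v^T *m Z = 0 by rewrite -[Z]sZ -trmx_mul Zv trmx0.
  have Gv : G *m v = 0.
    apply: possemidef_ker => //.
    have : qform (G + G) v = 0.
      rewrite -ZE qformD /qform !mulmxA vZ mul0mx mul0mx -!mulmxA Zv !mulmx0.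
      by rewrite !mxE addr0.
    by rewrite qformD -mulr2n => /eqP; rewrite mulrn_eq0 => /eqP.
  split=> //; have := congr1 (mulmx^~ v) ZE; rewrite NZ /=.
  rewrite mulmxBl !mulmxDl -!scalemxAl Zv !scaler0 Gv -!mulmxA Zv mulmx0.
  by rewrite !add0r => /eqP; rewrite oppr_eq0 => /eqP.
have posZ : posdef Z.
  split; first exact/symmetricmxP.
  move=> v vN0; rewrite lt_neqAle pZ.2 andbT; apply: contra_neq vN0 => /esym q0.
  apply: ctrl => k; apply: (kerZ _ _).1.
  elim: k => [|k IHk] /=; first exact: (possemidef_ker pZ q0).
  exact: (kerZ _ IHk).2.
have uZ := posdef_unitmx posZ.
exists (invmx Z); split; first by rewrite trmx_inv sZ.
rewrite -[M + _]trmxK; apply: antistable_tr.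
apply: (lyapunov_antistable posZ); rewrite trmxK mulmxDl mulmxKV //.
rewrite linearD /= trmx_mul trmx_inv sZ sG mulmxDr mulKVmx // addrACA -ZE NZ addrC subrK.
by apply: posdefD; last apply: posdefW; exact: posdefZ.
Qed.

(** For [M] the closed loop matrix at [P] and [G] the gain, this is the increment [F(P + X) - F(P)]
    of the Riccati map. *)
Definition care (n : nat) (M G X : 'M[R]_n) : 'M[R]_n := M^T *m X + X *m M + X *m G *m X.

Lemma care_closed_loop (n : nat) (M G X : 'M[R]_n) : G^T = G -> X^T = X ->
  (M + G *m X)^T *m X + X *m (M + G *m X) = care M G X + X *m G *m X.
Proof.
move=> sG sX; rewrite /care linearD /= trmx_mul sG sX mulmxDl mulmxDr !mulmxA.
by rewrite addrACA addrA.
Qed.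

(** [X] is its own Lyapunov certificate for the closed loop, which makes the next Newton step
    possible. *)
Lemma care_antistable (n : nat) (M G W X : 'M[R]_n) :
  possemidef G -> posdef W -> posdef X -> possemidef (care M G X - W) ->
  antistable (M + G *m X).
Proof.
move=> pG pW pX pD; have sX := posdef_tr pX; apply: (lyapunov_antistable pX).
rewrite care_closed_loop ?(possemidef_tr pG) // -[care _ _ _](subrK W) addrAC addrC.
apply: posdefD => //; apply: possemidefD => //.
by rewrite -[X in X *m G]sX; exact: possemidef_congr.
Qed.

(* Kleinman's iteration: [X'] solves the Lyapunov equation
   [(M + G X)^T X' + X' (M + G X) = W + X G X], and the quadratic error term of
   Newton's method has a sign. *)
Lemma newton_step (n : nat) (M G W X : 'M[R]_n) :
  possemidef G -> posdef W -> X^T = X -> antistable (M + G *m X) ->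
  exists X' : 'M[R]_n, [/\ posdef X', care M G X' - W = (X' - X) *m G *m (X' - X)
    & possemidef (care M G X - W) -> possemidef (X - X')].
Proof.
move=> pG pW sX asX; have sG := possemidef_tr pG.
have pXGX Y : Y^T = Y -> possemidef (Y *m G *m Y).
  by move=> sY; rewrite -[X in X *m G]sY; exact: possemidef_congr.
have pWX : posdef (W + X *m G *m X) by apply: posdefD; last exact: pXGX.
have [|X' sX' XE] := lyapunov_solution (W := W + X *m G *m X) asX; first exact: posdef_tr.
exists X'; split.
- by apply: (lyapunov_posdef asX); rewrite ?XE.
- have WE : M^T *m X' + X' *m M = W + X *m G *m X - X *m G *m X' - X' *m G *m X.
    rewrite -XE linearD /= trmx_mul sG sX mulmxDl mulmxDr !mulmxA.
    move: (M^T *m X') (X' *m M) (X *m G *m X') (X' *m G *m X) => p q r s.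
    by apply/matrixP => i j; rewrite !mxE; ring.
  rewrite /care WE !(mulmxBl, mulmxBr).
  move: (X *m G *m X) (X' *m G *m X') (X *m G *m X') (X' *m G *m X) => p q r s.
  by apply/matrixP => i j; rewrite !mxE; ring.
(* Subtracting the two Lyapunov equations leaves [care M G X - W] on the right. The initial feedback
   may violate this sign condition, so the descent starts one step later. *)
move=> pX; apply: (lyapunov_possemidef asX); first by rewrite linearB /= sX sX'.
rewrite mulmxBl mulmxBr addrACA -opprD XE care_closed_loop //.
by rewrite opprD addrACA subrr addr0.
Qed.

End Kleinman.

(** * The limit of the Newton iteration *)

Section CareSolution.
Context (R : realType).

(** Entrywise, so that every limit reduces to scalar sequences. *)
Definition mx_cvg (k l : nat) (u : nat -> 'M[R]_(k, l)) (L : 'M[R]_(k, l)) :=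
  forall i j, (fun t => u t i j) @ \oo --> L i j.

Lemma mx_cvg_cst (k l : nat) (L : 'M[R]_(k, l)) : mx_cvg (fun=> L) L.
Proof. by move=> i j; exact: cvg_cst. Qed.

Lemma mx_cvg_ext (k l : nat) (u v : nat -> 'M[R]_(k, l)) L :
  u =1 v -> mx_cvg u L -> mx_cvg v L.
Proof. by move=> /funext ->. Qed.

Lemma mx_cvgD (k l : nat) (u v : nat -> 'M[R]_(k, l)) U V :
  mx_cvg u U -> mx_cvg v V -> mx_cvg (fun t => u t + v t) (U + V).
Proof.
move=> uU vV i j; rewrite mxE; under eq_fun do rewrite mxE.
exact: cvgD (uU i j) (vV i j).
Qed.

Lemma mx_cvgB (k l : nat) (u v : nat -> 'M[R]_(k, l)) U V :
  mx_cvg u U -> mx_cvg v V -> mx_cvg (fun t => u t - v t) (U - V).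
Proof.
move=> uU vV i j; rewrite !mxE; under eq_fun do rewrite !mxE.
exact: cvgB (uU i j) (vV i j).
Qed.

Lemma mx_cvgM (k l q : nat) (u : nat -> 'M[R]_(k, l)) (v : nat -> 'M[R]_(l, q)) U V :
  mx_cvg u U -> mx_cvg v V -> mx_cvg (fun t => u t *m v t) (U *m V).
Proof.
move=> uU vV i j; rewrite !mxE; under eq_fun do rewrite !mxE.
apply: cvg_big => [|h _]; first by move=> x; exact: add_continuous.
exact: cvgM (uU i h) (vV h j).
Qed.

Lemma mx_cvg_shift (k l : nat) (u : nat -> 'M[R]_(k, l)) L :
  mx_cvg u L -> mx_cvg (fun t => u t.+1) L.
Proof. by move=> uL i j; have := uL i j; rewrite -cvg_shiftS. Qed.

Lemma mx_cvg_unique (k l : nat) (u : nat -> 'M[R]_(k, l)) U V :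
  mx_cvg u U -> mx_cvg u V -> U = V.
Proof.
by move=> uU uV; apply/matrixP => i j; apply: (cvg_unique _ (uU i j) (uV i j)).
Qed.

Lemma mx_cvg_tr (k l : nat) (u : nat -> 'M[R]_(k, l)) L :
  mx_cvg u L -> mx_cvg (fun t => (u t)^T) L^T.
Proof. by move=> uL i j; rewrite mxE; under eq_fun do rewrite mxE; exact: uL. Qed.

Lemma mx_cvg_possemidef (n : nat) (u : nat -> 'M[R]_n) L :
  mx_cvg u L -> (forall t, possemidef (u t)) -> possemidef L.
Proof.
move=> uL pu; split.
  apply/symmetricmxP; apply: (mx_cvg_unique (mx_cvg_tr uL)).
  by apply: mx_cvg_ext uL => t; rewrite possemidef_tr.
move=> x; have : mx_cvg (fun t => x^T *m u t *m x) (x^T *m L *m x).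
  by do 2?apply: mx_cvgM => //; exact: mx_cvg_cst.
move=> /(_ 0 0) qL; rewrite /qform -(cvg_lim _ qL) //.
apply: limr_ge; first by apply/cvg_ex; eexists; exact: qL.
by near=> t; exact: (pu t).2.
Unshelve. all: by end_near. Qed.

(** At each fixed vector the forms decrease and are bounded below by 0; polarization then recovers
    the entries. *)
Lemma decreasing_mx_cvg (n : nat) (u : nat -> 'M[R]_n) :
  (forall t, possemidef (u t)) -> (forall t, possemidef (u t - u t.+1)) ->
  exists L, mx_cvg u L.
Proof.
move=> pu du.
have cvq x : cvgn (fun t => qform (u t) x).
  apply: nonincreasing_is_cvgn.
    apply/nonincreasing_seqP => t; rewrite -subr_ge0 -qformB; exact: (du t).2.
  by exists 0 => _ [t _ <-]; exact: (pu t).2.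
have entryE t i j : u t i j = (qform (u t) (delta_mx i 0 + delta_mx j 0)
    - qform (u t) (delta_mx i 0) - qform (u t) (delta_mx j 0)) / 2.
  rewrite -[X in qform _ (_ + X)]scale1r qform_addZ ?possemidef_tr // expr1n !mul1r.
  have -> : bform (u t) (delta_mx j 0) (delta_mx i 0) = u t i j.
    by rewrite /bform trmx_delta -rowE -colE !mxE -[in RHS](possemidef_tr (pu t)) mxE.
  by field.
pose q x := limn (fun t => qform (u t) x).
exists (\matrix_(i, j) ((q (delta_mx i 0 + delta_mx j 0) - q (delta_mx i 0) - q (delta_mx j 0))
  / 2)).
move=> i j; rewrite mxE; under eq_fun do rewrite entryE.
apply: cvgMl; apply: cvgB; first apply: cvgB; exact: cvq.
Qed.

Lemma care_solution (n : nat) (M G W : 'M[R]_n) :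
  possemidef G -> posdef W ->
  (forall v : 'cV_n, (forall k, G *m iter k (mulmx M^T) v = 0) -> v = 0) ->
  exists X : 'M[R]_n, [/\ posdef X, care M G X = W & antistable (M + G *m X)].
Proof.
move=> pG pW ctrl; have [X0 [sX0 asX0]] := bass_antistable pG ctrl.
have pGG Y : Y^T = Y -> possemidef (Y *m G *m Y).
  by move=> sY; rewrite -[X in X *m G]sY; exact: possemidef_congr.
(* The invariants of the iteration are bundled into a type, as dependent choice requires a total
   step. *)
pose T := {X : 'M[R]_n | posdef X /\ possemidef (care M G X - W)}.
pose rel (X Y : T) := care M G (sval Y) - W = (sval Y - sval X) *m G *m (sval Y - sval X)
  /\ possemidef (sval X - sval Y).
have [X1 [pX1 dX1 _]] := newton_step pG pW sX0 asX0.
have dX1' : possemidef (care M G X1 - W).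
  by rewrite dX1; apply: pGG; rewrite linearB /= sX0 (posdef_tr pX1).
have step (X : T) : {Y : T | rel X Y}.
  apply: cid; case: X => X [pX dX].
  have [Y [pY dY mY]] := newton_step pG pW (posdef_tr pX) (care_antistable pG pW pX dX).
  have dY' : possemidef (care M G Y - W).
    by rewrite dY; apply: pGG; rewrite linearB /= !posdef_tr.
  by exists (exist _ Y (conj pY dY')); split=> //=; exact: mY.
have [f [_ frel]] := dependent_choice step (exist _ X1 (conj pX1 dX1')).
pose u t := sval (f t).
have pu t : posdef (u t) by exact: (svalP (f t)).1.
have [L uL] := decreasing_mx_cvg (fun t => posdefW (pu t)) (fun t => (frel t).2).
have pL : possemidef L by apply: mx_cvg_possemidef uL _ => t; exact: posdefW.
have sL := possemidef_tr pL.
have cL : care M G L = W.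
  apply/eqP; rewrite -subr_eq0; apply/eqP.
  have uS := mx_cvg_shift uL.
  have h1 : mx_cvg (fun t => care M G (u t.+1) - W) (care M G L - W).
    apply: mx_cvgB; last exact: mx_cvg_cst.
    apply: mx_cvgD; first apply: mx_cvgD; apply: mx_cvgM => //; try exact: mx_cvg_cst.
    by apply: mx_cvgM => //; exact: mx_cvg_cst.
  (* The residual is quadratic in the difference of consecutive iterates, hence tends to 0. *)
  have h2 : mx_cvg (fun t => care M G (u t.+1) - W) ((L - L) *m G *m (L - L)).
    apply: (@mx_cvg_ext _ _ (fun t => (u t.+1 - u t) *m G *m (u t.+1 - u t))).
      by move=> t; rewrite -(frel t).1.
    apply: mx_cvgM; last exact: mx_cvgB.
    by apply: mx_cvgM; [exact: mx_cvgB | exact: mx_cvg_cst].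
  by rewrite (mx_cvg_unique h1 h2) subrr mulmx0.
have posL : posdef L.
  split; first exact/symmetricmxP.
  (* If the form of [L] vanished at [x], then [L x = 0], and the equation would give
     [qform W x = 0]. *)
  move=> x xN0; rewrite lt_neqAle pL.2 andbT; apply: contraTneq (pW.2 _ xN0) => /esym q0.
  have Lx := possemidef_ker pL q0.
  have xL : x^T *m L = 0 by rewrite -[L]sL -trmx_mul Lx trmx0.
  rewrite -cL /care !qformD /qform !mulmxA xL !mul0mx -!mulmxA Lx !mulmx0.
  by rewrite mxE !addr0 ltxx.
exists L; split; [exact: posL | exact: cL |].
by apply: (care_antistable pG pW posL); rewrite cL subrr; exact: possemidef0.
Qed.

End CareSolution.

(** * The Riccati map of the problem *)

Section Riccati.
Context (R : realType) (n m p : nat).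
Context (A : 'M[R]_n) (B : 'M[R]_(n, m)).
Context (Q : 'I_p.+1 -> 'M[R]_n)
        (S : 'I_p.+1 -> 'M[R]_(n, m)) (Rm : 'I_p.+1 -> 'M[R]_m).
Context (hQ : forall i, Q i \is symmetricmx).
Implicit Types (l : 'cV[R]_p) (P X D : 'M[R]_n).

Local Notation riccati := (riccati A B Q S Rm).
Local Notation closed_loop := (closed_loop A B S Rm).

Lemma affine_mx_tr (k : nat) (H : 'I_p.+1 -> 'M[R]_k) l :
  (forall i, H i \is symmetricmx) -> (affine_mx H l)^T = affine_mx H l.
Proof.
move=> sH; rewrite /affine_mx linearD linear_sum /=.
have tH i : (H i)^T = H i by apply/symmetricmxP.
by rewrite tH; congr (_ + _); apply: eq_bigr => i _; rewrite linearZ /= tH.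
Qed.

(** The Kalman matrix has independent rows, and [v^T] annihilates each of its blocks. Iterates are
    used to match the hypothesis of [bass_antistable]. *)
Lemma controllable_observable (v : 'cV[R]_n) :
  controllable A B -> (forall k, B^T *m iter k (mulmx A^T) v = 0) -> v = 0.
Proof.
move=> AB Bv; have iterE k : iter k (mulmx A^T) v = (v^T *m (A ^+ k))^T.
  elim: k => [|k IHk] /=; first by rewrite expr0 -[1]/(1%:M) mulmx1 trmxK.
  by rewrite IHk -trmx_mul -mulmxA exprSr.
have : v^T *m \mxrow_(i < n) (A ^+ i *m B) = 0.
  rewrite mul_mxrow -[RHS]mxrow0; apply/eq_mxrow => i.
  apply: trmx_inj; rewrite mulmxA trmx_mul -iterE Bv trmx0 //.
move=> vK; apply: trmx_inj; rewrite trmx0.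
by apply: (row_free_inj (A := \mxrow_(i < n) (A ^+ i *m B))); rewrite /row_free ?AB ?mul0mx.
Qed.

(* [G = B (- R)^-1 B^T], so that [F(P + D) = F(P) + K^T D + D K + D G D]. *)
Definition gain l : 'M[R]_n := B *m invmx (- affine_mx Rm l) *m B^T.

Lemma gain_possemidef l : negdef (affine_mx Rm l) -> possemidef (gain l).
Proof.
move=> /posdef_inv/posdefW pV; rewrite /gain -{1}(trmxK B).
exact: possemidef_congr.
Qed.

Lemma invmx_opp (k : nat) (M : 'M[R]_k) : invmx (- M) = - invmx M.
Proof.
have [uM|nuM] := boolP (M \in unitmx).
  by rewrite -scaleN1r invmxZ ?unitmxZ ?unitrN1 ?unitr1 // invrN1 scaleN1r.
(* On singular matrices [invmx] is the identity map, which also commutes with the sign. *)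
by rewrite /invmx -scaleN1r unitmxZ ?unitrN1 ?unitr1 // (negbTE nuM) scaleN1r.
Qed.

Lemma negdef_invmx_tr l : negdef (affine_mx Rm l) ->
  (invmx (affine_mx Rm l))^T = invmx (affine_mx Rm l).
Proof.
move=> /posdef_inv/posdef_tr; rewrite invmx_opp linearN /=; exact: oppr_inj.
Qed.

Lemma closed_loopD l P D : D^T = D -> closed_loop (P + D) l = closed_loop P l + gain l *m D.
Proof.
move=> sD; rewrite /closed_loop /Defs.closed_loop /gain mulmxDl addrAC linearD /= mulmxDr opprD
  addrA.
by rewrite trmx_mul sD invmx_opp !mulmxN !mulNmx !mulmxA.
Qed.

Lemma riccatiD l P D : negdef (affine_mx Rm l) -> D^T = D ->
  riccati (P + D) l = riccati P l + care (closed_loop P l) (gain l) D.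
Proof.
move=> nR sD; rewrite /riccati /Defs.riccati /closed_loop /Defs.closed_loop /care /gain invmx_opp.
have := negdef_invmx_tr nR; set V := invmx _; set E := P *m B + _ => sV.
have -> : (P + D) *m B + affine_mx S l = E + D *m B by rewrite mulmxDl addrAC.
rewrite [(E + _)^T]linearD [(A - _)^T]linearB /= !trmx_mul !trmxK sV sD.
rewrite !(mulmxDl, mulmxDr, mulNmx, mulmxN) !mulmxA.
move: (A^T *m P) (A^T *m D) (P *m A) (D *m A) (affine_mx Q l) (E *m V *m E^T).
move: (D *m B *m V *m E^T) (E *m V *m B^T *m D) (D *m B *m V *m B^T *m D).
by move=> a b c d e f g h k; apply/matrixP => i j; rewrite !mxE; ring.
Qed.

(** Multiplied out, the matrix has diagonal blocks [A^T P + P A + Q] and [R] and upper right block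
    [P B + S]; the Schur complement of [R] in it is [F(P)]. *)
Lemma lmi_riccati l P : P^T = P ->
  negdef (lmi_mx A B Q S Rm l P) <-> negdef (affine_mx Rm l) /\ posdef (- riccati P l).
Proof.
move=> sP; set E := A^T *m P + P *m A + affine_mx Q l; set f := P *m B + affine_mx S l.
have -> : lmi_mx A B Q S Rm l P = block_mx E f f^T (affine_mx Rm l).
  rewrite /lmi_mx tr_block_mx !mulmx_block !(mulmx0, mul0mx, trmx0, trmx1, mul1mx, addr0, add0r).
  rewrite mulmx1 add_block_mx add0r /f [(_ + _)^T]linearD /= trmx_mul sP.
  by rewrite mulmx1 [P *m A + _]addrC.
have sE : (- E)^T = - E.
  rewrite linearN /=; congr (- _); rewrite /E [(_ + affine_mx Q l)^T]linearD /= [(_ +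
    _)^T]linearD /=.
  by rewrite !trmx_mul trmxK sP affine_mx_tr // [P *m A + _]addrC.
rewrite /negdef opp_block_mx -linearN /= (posdef_block _ _ sE) invmx_opp.
have -> : - E - - f *m - invmx (affine_mx Rm l) *m (- f)^T = - riccati P l.
  rewrite [(- f)^T]linearN /= !(mulmxN, mulNmx) !opprK /Defs.riccati.
  by rewrite opprB addrC.
by [].
Qed.

(* [X = Pp - P] satisfies [K^T X + X K = - F(P) + X G X > 0] for the anti-stable
   closed loop matrix [K] at [Pp]. *)
Lemma antistabilizing_maximal l P Pp : negdef (affine_mx Rm l) ->
  antistabilizing_solution A B Q S Rm l Pp -> P^T = P -> posdef (- riccati P l) ->
  posdef (Pp - P).
Proof.
move=> nR [/symmetricmxP sPp ric0 asM] sP posF.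
have sD : (P - Pp)^T = P - Pp by rewrite linearB /= sP sPp.
have := riccatiD Pp nR sD; rewrite [Pp + _]addrC subrK ric0 add0r => ricE.
rewrite -opprB; apply: (lyapunov_posdef asM); first by rewrite linearN /= sD.
rewrite mulmxN mulNmx -opprD.
have -> : - ((closed_loop Pp l)^T *m (P - Pp) + (P - Pp) *m closed_loop Pp l)
  = - riccati P l + (P - Pp) *m gain l *m (P - Pp).
  by rewrite ricE /care [in RHS]opprD subrK.
apply: posdefD => //; rewrite -[X in X *m gain l]sD.
exact/possemidef_congr/gain_possemidef.
Qed.

Lemma antistabilizing_exists l P : controllable A B -> negdef (affine_mx Rm l) ->
  P^T = P -> posdef (- riccati P l) -> exists Pp, antistabilizing_solution A B Q S Rm l Pp.
Proof.
move=> AB nR sP posF; have pG := gain_possemidef nR.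
(* [- R] is positive definite, so [gain l] and [B^T] have the same kernel. *)
have BG (u : 'cV_n) : gain l *m u = 0 -> B^T *m u = 0.
  move=> Gu; apply/eqP; apply: contraT => /(posdef_inv nR).2.
  by rewrite -qform_congr trmxK -/(gain l) /qform -mulmxA Gu mulmx0 mxE ltxx.
have [v Gv|X [pX cX asX]] := care_solution pG posF (M := closed_loop P l).
  apply: (controllable_observable AB) => k.
  (* Feedback does not change the unobservable vectors: where [B^T] vanishes, the transposed closed
     loop acts as [A^T]. *)
  have stepE (u : 'cV_n) : B^T *m u = 0 -> (closed_loop P l)^T *m u = A^T *m u.
    move=> Bu; rewrite /closed_loop /Defs.closed_loop linearB /= mulmxBl !trmx_mul -!mulmxA.
    by rewrite Bu !mulmx0 subr0.
  have iterE : forall k, iter k (mulmx (closed_loop P l)^T) v = iter k (mulmx A^T) v.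
    by elim=> [//|j IHj] /=; rewrite -IHj stepE // BG.
  by rewrite -iterE BG.
have sX := posdef_tr pX; exists (P + X); split.
- by apply/symmetricmxP; rewrite linearD /= sP sX.
- by rewrite [LHS](riccatiD P nR sX) cX subrr.
- by rewrite [X in antistable X](closed_loopD l P sX).
Qed.

Lemma antistabilizing_approx l Pp : negdef (affine_mx Rm l) ->
  antistabilizing_solution A B Q S Rm l Pp -> posdef Pp ->
  exists2 X : 'M[R]_n, X^T = X & exists2 e : R, 0 < e &
    forall t, 0 < t <= e -> posdef (Pp - t *: X) /\ posdef (- riccati (Pp - t *: X) l).
Proof.
move=> nR [/symmetricmxP sPp ric0 asM] pP.
have [|X sX XE] := lyapunov_solution (W := 1%:M) asM; first by rewrite tr_scalar_mx.
exists X => //; have [e1 e1_gt0 He1] := posdef_perturb pP sX.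
have [|e2 e2_gt0 He2] := posdef_perturb (Y := X *m gain l *m X) (posdef1 R n).
  by apply: possemidef_tr; rewrite -[X in X *m gain l]sX; exact/possemidef_congr/gain_possemidef.
(* [e1] keeps [Pp - t X] positive definite, [e2] keeps [1 - t X G X] so. *)
exists (Num.min e1 e2); first by rewrite lt_min e1_gt0.
move=> t /andP[t0]; rewrite le_min => /andP[te1 te2]; split.
  by apply: He1; rewrite (ltW t0).
rewrite [riccati _ _](riccatiD _ nR); last by rewrite linearN linearZ /= sX.
have -> : - (Defs.riccati A B Q S Rm Pp l + care (closed_loop Pp l) (gain l) (- (t *: X)))
    = t *: (1%:M - t *: (X *m gain l *m X)).
  rewrite ric0 add0r -XE /care !(mulmxN, mulNmx) opprK -!scalemxAr -!scalemxAl.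
  move: ((closed_loop Pp l)^T *m X) (X *m closed_loop Pp l) (X *m gain l *m X) => a b d.
  by apply/matrixP => i j; rewrite !mxE; ring.
by apply: posdefZ => //; apply: He2; rewrite (ltW t0).
Qed.

End Riccati.

Theorem theorem1 (R : realType) (n m p r : nat)
    (hn : (0 < n)%N) (hm : (0 < m)%N) (hp : (0 < p)%N) (hr : (0 < r)%N)
    (A : 'M[R]_n) (B : 'M[R]_(n, m)) (c : 'cV[R]_p) (Sigma : 'M[R]_n)
    (N : 'I_p.+1 -> 'M[R]_r) (Q : 'I_p.+1 -> 'M[R]_n)
    (S : 'I_p.+1 -> 'M[R]_(n, m)) (Rm : 'I_p.+1 -> 'M[R]_m)
    (hN : forall i, N i \is symmetricmx)
    (hQ : forall i, Q i \is symmetricmx)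
    (hRm : forall i, Rm i \is symmetricmx)
    (hAB : controllable A B)
    (hSigma : possemidef Sigma) :
  value_I A B c Sigma N Q S Rm = value_II A B c Sigma N Q S Rm /\
  (forall l : 'cV[R]_p,
     feasible_II A B N Q S Rm l <->
     exists P : 'M[R]_n, feasible_I A B N Q S Rm l P).
Proof.
(* Membership in the domain excludes the default value of [xget]. *)
have domP l : riccati_domain A B Q S Rm l ->
    antistabilizing_solution A B Q S Rm l (P_plus A B Q S Rm l).
  by case=> _; exact: (@xgetPex _ 0 [set P | antistabilizing_solution A B Q S Rm l P]).
have I_to_II l P : feasible_I A B N Q S Rm l P ->
    feasible_II A B N Q S Rm l /\ posdef (P_plus A B Q S Rm l - P).
  move=> [/symmetricmxP sP /(lmi_riccati A B S Rm hQ l sP)[nR posF] posN posP].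
  have dom : riccati_domain A B Q S Rm l.
    by split=> //; exact: antistabilizing_exists hAB nR sP posF.
  have posD := antistabilizing_maximal nR (domP l dom) sP posF.
  split=> //; split=> //; rewrite -(subrK P (P_plus _ _ _ _ _ _)).
  exact: posdefD (posdefW _).
have II_to_I l : feasible_II A B N Q S Rm l ->
    exists2 X : 'M[R]_n, X^T = X & exists2 e : R, 0 < e &
    forall t, 0 < t <= e -> feasible_I A B N Q S Rm l (P_plus A B Q S Rm l - t *: X).
  move=> [posN posP dom]; have [nR _] := dom.
  have [X sX [e e0 He]] := antistabilizing_approx nR (domP l dom) posP.
  exists X => //; exists e => // t te; have [posPt posF] := He t te.
  split=> //; first exact: posPt.1.
  exact/(lmi_riccati A B S Rm hQ l (posdef_tr posPt)).
split; last first.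
  move=> l; split=> [/II_to_I[X sX [e e0 He]]|[P /I_to_II[]//]].
  by exists (P_plus A B Q S Rm l - e *: X); apply: He; rewrite e0 lexx.
apply/eqP; rewrite eq_le; apply/andP; split.
  apply: le_ereal_inf_tmp => _ [l /II_to_I[X sX [e e0 He]] <-].
  apply/lee_addgt0Pr => d d0.
  (* Moving from [P_plus] by [- t X] raises the objective by [t] times the trace of [Sigma X], which
     this [t] keeps below [d]; the [+ 1] avoids division by 0. *)
  pose t := Num.min e (d / (`|\tr (Sigma *m X)| + 1)).
  have c0 : 0 < `|\tr (Sigma *m X)| + 1 by rewrite ltr_wpDl.
  have t0 : 0 < t by rewrite lt_min e0 divr_gt0.
  have te : 0 < t <= e by rewrite t0 ge_min lexx.
  apply: le_trans (ereal_inf_lbound _) _.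
    exists (l, P_plus A B Q S Rm l - t *: X) => /=; [exact: He | by []].
  rewrite /= lee_fin /objective mulmxBr linearB /= -scalemxAr linearZ /= opprB.
  rewrite [t * _ - _]addrC addrA lerD2l.
  have : t * (`|\tr (Sigma *m X)| + 1) <= d.
    by rewrite -ler_pdivlMr // ge_min lexx orbT.
  apply: le_trans; rewrite ler_wpM2l ?ltW //.
  by rewrite (le_lt_trans (ler_norm _)) // ltrDl.
(* For the same [l], replacing [P] by the larger [P_plus] cannot increase the objective, since
   [Sigma] is positive semi-definite. *)
apply: le_ereal_inf_tmp => _ [[l P] /= /I_to_II[fII posD] <-].
apply: le_trans (ereal_inf_lbound _) _; first by exists l.
rewrite lee_fin /objective lerD2l lerN2 -subr_ge0 -linearB /= -mulmxBr.
exact: trace_mul_ge0.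
Qed.
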